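(* Let $C_n$ denote the cycle on $n\ge 3$ vertices. (1) If $n$ is even, then $\mathcal{E}_{\mathrm{per}}(C_n)=\dfrac{4}{\sin(\pi/n)}$. (2) If $n$ is odd, then $\displaystyle\lim_{n\to\infty,\ n\text{ odd}}\frac{\mathcal{E}_{\mathrm{per}}(C_n)}{n}=\frac{4}{\pi}$.
   Context: For a simple graph $G$ on $n$ vertices with adjacency matrix $A(G)$, the permanental polynomial is $\pi(G,x)=\operatorname{per}(xI-A(G))$, where $\operatorname{per}(M)=\sum_{\sigma\in S_n}\prod_i m_{i,\sigma(i)}$; its roots $\mu_1,\dots,\mu_n\in\mathbb{C}$ are counted with multiplicity, and the permanental energy is $\mathcal{E}_{\mathrm{per}}(G)=\sum_{i=1}^n|\mu_i|$. *)

(* Defs.v *)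
From HB Require Import structures.
From mathcomp Require Import all_boot all_order all_algebra all_fingroup.
From mathcomp Require Import all_classical all_reals all_analysis.
From mathcomp Require Import complex.

Set Implicit Arguments.
Unset Strict Implicit.
Unset Printing Implicit Defensive.

Import Order.TTheory GRing.Theory Num.Theory.
Import numFieldNormedType.Exports.

Local Open Scope ring_scope.

Record simple_graph (n : nat) := SimpleGraph {
  adj :> rel 'I_n;
  adj_sym : symmetric adj;
  adj_irr : irreflexive adj
}.

Definition adjmx (F : nzRingType) n (G : simple_graph n) : 'M[F]_n :=
  \matrix_(i, j) (G i j)%:R.

Definition permanent (F : comNzRingType) n (M : 'M[F]_n) : F :=
  \sum_(s : 'S_n) \prod_(i < n) M i (s i).

(* [char_poly_mx A] is the matrix xI - A. *)
Definition permanental_poly (F : comNzRingType) n (G : simple_graph n) :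
    {poly F} :=
  permanent (char_poly_mx (adjmx F G)).

(* The roots of a nonzero polynomial, repeated according to multiplicity: [r]
   is characterised up to permutation by p = lead_coef p * \prod_(z in r)
   ('X - z). *)
Definition poly_roots (F : closedFieldType) (p : {poly F}) : seq F :=
  sval (closed_field_poly_normal p).

(* [normc] is the R-valued complex modulus; the norm `|_| of R[i] is
   R[i]-valued. *)
Definition permanental_energy (R : realType) n (G : simple_graph n) : R :=
  \sum_(mu <- poly_roots (permanental_poly R[i] G)) ComplexField.Normc.normc mu.

(* [ordS i] is i + 1 mod n.  The condition i != j matters only for n = 1,
   where it removes the loop; for n >= 3 this is the usual cycle C_n. *)
Definition cycle_rel n : rel 'I_n :=
  fun i j => (i != j) && ((j == ordS i) || (i == ordS j)).

Lemma cycle_rel_sym n : symmetric (@cycle_rel n).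
Proof. by move=> i j; rewrite /cycle_rel eq_sym orbC. Qed.

Lemma cycle_rel_irr n : irreflexive (@cycle_rel n).
Proof. by move=> i; rewrite /cycle_rel eqxx. Qed.

Definition cycle_graph n : simple_graph n :=
  SimpleGraph (@cycle_rel_sym n) (@cycle_rel_irr n).

(* Main.v *)
(* Write T(x,a,b) for the circulant matrix with x on the diagonal, a on the
   cyclic superdiagonal and b on the cyclic subdiagonal, so that
   xI - A(C_n) = T(x,-1,-1).  For n >= 3, a permutation moving every index by
   at most one step is one of the two rotations or a product of k disjoint
   transpositions (i,i+1); the latter have sign (-1)^k.  So if a b = -1, the
   expansions of per T(x,-1,-1) and det T(x,a,b) agree except at the rotations.
   Choosing a = -c, b = 1/c with (-c)^n + c^(-n) = -2 makes the rotation terms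
   agree as well, and diagonalising the circulant T(x,-c,1/c) gives the roots
   c w^k - 1/(c w^k), with w a primitive n-th root of unity.
   For n even, c = e^(i pi/n) makes the roots 2i sin((2k+1)pi/n).
   For n odd, c > 0 with c^n = 1 + sqrt 2 gives roots of modulus
   sqrt((c - 1/c)^2 + 4 sin^2(k pi/n)); since c -> 1, the mean of the moduli
   has the same limit as the mean of 2 sin(k pi/n), a cotangent. *)
Require Import Defs.
From mathcomp Require Import all_boot all_order all_algebra all_fingroup.
From mathcomp Require Import all_classical all_reals all_analysis.
From mathcomp Require Import complex.
From mathcomp Require Import zify ring lra.
Set Implicit Arguments.
Unset Strict Implicit.
Unset Printing Implicit Defensive.

Import Order.TTheory GRing.Theory Num.Theory.
Import numFieldNormedType.Exports.
Local Open Scope ring_scope.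

(** * Permutations moving each index by at most one cyclic step *)

(** [A] picks one point from each 2-cycle, so [s] is a product of [#|A|] transpositions; the
    induction splits off the one through a point [x] of [A]. *)
Lemma odd_perm_involution (T : finType) (s : {perm T}) (A : {set T}) :
    (forall x, s (s x) = x) ->
    (forall x, x \in A -> s x != x) ->
    (forall x, s x != x -> (x \in A) (+) (s x \in A)) ->
  odd_perm s = odd #|A|.
Proof.
have [m] := ubnP #|A|; elim: m s A => // m IH s A leAm sK sA sN.
have [A0|[x xA]] := set_0Vmem A.
  suff -> : s = 1%g by rewrite odd_perm1 A0 cards0.
  apply/permP => x; rewrite perm1; apply/eqP/negPn/negP => /sN.
  by rewrite A0 !inE.
have nx := sA x xA.
have sxA : s x \notin A by have := sN x nx; rewrite xA.
pose t := (tperm x (s x) * s)%g.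
have tE y : t y = if (y == x) || (y == s x) then y else s y.
  rewrite permM; case: tpermP => [->|->|/eqP/negPf-> /eqP/negPf->] //.
    by rewrite eqxx sK.
  by rewrite eqxx orbT.
have tnx y : t y != y -> y != x /\ y != s x.
  by rewrite tE; case: ifP => [|/norP//]; rewrite eqxx.
have := odd_mul_tperm x (s x) s; rewrite -/t eq_sym nx /= => ot.
rewrite (cardsD1 x) xA /= -(IH t) ?ot ?negbK //.
- by move: leAm; rewrite (cardsD1 x) xA.
- move=> y; have [ty|/tnx [yx ysx]] := eqVneq (t y) y; first by rewrite ty.
  have -> : t y = s y by rewrite tE (negPf yx) (negPf ysx).
  by rewrite tE (can_eq sK) (negPf yx) -{1}(sK x) (can_eq sK) (negPf ysx) sK.
- move=> y; rewrite !inE => /andP[yx yA]; rewrite tE (negPf yx) /=.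
  by have [e|_] := eqVneq y (s x); [rewrite e (negPf sxA) in yA | exact: sA].
- move=> y ty; have [yx ysx] := tnx _ ty.
  move: ty; rewrite tE (negPf yx) (negPf ysx) /= => /sN.
  by rewrite !inE yx /= -{1}(sK x) (can_eq sK) ysx.
Qed.

Lemma val_iter_ordS n (i : 'I_n) k : iter k (@ordS n) i = ((i + k) %% n)%N :> nat.
Proof.
elim: k => [|k IH] /=; first by rewrite addn0 modn_small.
by rewrite IH -addn1 modnDml addn1 addnS.
Qed.

Lemma iter_ordSE n (i j : 'I_n) : exists k, j = iter k (@ordS n) i.
Proof.
exists (n - i + j)%N; apply: val_inj => /=; rewrite val_iter_ordS.
by rewrite addnA subnKC 1?ltnW // modnDl modn_small.
Qed.

Lemma ordS_neq n (i : 'I_n) : (1 < n)%N -> ordS i != i.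
Proof.
move=> n1; apply/eqP => /(congr1 val) /=; have := ltn_ord i.
move: (nat_of_ord i) => k kn.
have [kn1|kn1] := eqVneq k.+1 n; first by rewrite kn1 modnn; lia.
by rewrite modn_small; lia.
Qed.

Lemma ordSS_neq n (i : 'I_n) : (2 < n)%N -> ordS (ordS i) != i.
Proof.
move=> n2; apply/eqP => /(congr1 (@nat_of_ord n)).
rewrite (val_iter_ordS i 2).
have := ltn_ord i; move: (nat_of_ord i) => k kn.
have [kn2|kn2] := ltnP (k + 2)%N n; first by rewrite modn_small; lia.
rewrite -(subnK kn2) modnDr modn_small; lia.
Qed.

Definition rot_perm n : 'S_n := perm (@ordS_inj n).

Definition near_diag n (s : 'S_n) :=
  forall i, [\/ s i = i, s i = ordS i | i = ordS (s i)].

(** A forward step not undone by a swap propagates: at [ordS i], staying put contradicts injectivity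
    and going back is excluded, so [s] steps forward again, all around the cycle. *)
Lemma rot_permP n (s : 'S_n) i : (2 < n)%N -> near_diag s ->
  s i = ordS i -> s (ordS i) != i -> s = rot_perm n.
Proof.
move=> n2 ds si sSi.
have step j : s j = ordS j -> s (ordS j) != j -> s (ordS j) = ordS (ordS j).
  move=> sj sSj; case: (ds (ordS j)) => // [e|/ordS_inj e].
    move: e; rewrite -{2}sj => /perm_inj /eqP.
    by rewrite (negPf (ordS_neq _ _)) // ltnW.
  by rewrite -e eqxx in sSj.
have all_k k : s (iter k (@ordS n) i) = iter k.+1 (@ordS n) i /\
               s (iter k.+1 (@ordS n) i) = iter k.+2 (@ordS n) i.
  elim: k => [|k [IH1 IH2]]; first by split=> //; exact: step.
  split=> //; apply: step => //.
  (* Going back would give two points two steps apart the same image. *)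
  by rewrite -[X in _ != X]IH1 (inj_eq perm_inj) ordSS_neq.
apply/permP => j; rewrite permE; have [k ->] := iter_ordSE i j.
by have [] := all_k k.
Qed.

Lemma near_diagV n (s : 'S_n) : near_diag s -> near_diag s^-1%g.
Proof.
move=> ds i; case: (ds (s^-1 i)%g); rewrite permKV => e.
- by apply: Or31; rewrite -e.
- by apply: Or33.
- by apply: Or32.
Qed.

Lemma near_diag_involution n (s : 'S_n) : (2 < n)%N -> near_diag s ->
  s != rot_perm n -> s != (rot_perm n)^-1%g -> forall i, s (s i) = i.
Proof.
move=> n2 ds sr srV i; case: (ds i) => [si|si|si]; first by rewrite !si.
  rewrite si; apply/eqP/negPn/negP => h.
  by move: sr; rewrite (rot_permP n2 ds si h) eqxx.
(* A backward step of [s] at [i] is a forward step of its inverse at [s i], so [rot_permP] applies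
   to the inverse. *)
have sV : (s^-1 (s i) = ordS (s i))%g by rewrite permK.
have [e|ne] := eqVneq (s^-1 (ordS (s i)))%g (s i).
  by rewrite -{1}e permKV -si.
by move: srV; rewrite -(rot_permP n2 (near_diagV ds) sV ne) invgK eqxx.
Qed.

(** The rotation has a single orbit, and the parity is that of the number of points plus the number
    of orbits. *)
Lemma odd_rot_perm n : odd_perm (rot_perm n.+1) = odd n.
Proof.
rewrite /odd_perm card_ord.
suff -> : porbits (rot_perm n.+1) = [set [set: 'I_n.+1]].
  by rewrite cards1 /= addbT negbK.
have pT i : porbit (rot_perm n.+1) i = [set: 'I_n.+1].
  apply/setP => j; rewrite !inE; have [k ->] := iter_ordSE i j.
  apply/porbitP; exists k; elim: k => [|k IH]; first by rewrite perm1.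
  by rewrite expgSr permM -IH permE.
apply/setP => X; rewrite inE; apply/imsetP/eqP => [[i _ ->]|->]; first exact: pT.
by exists ord0; rewrite ?pT.
Qed.

(** * Permanent against determinant for the circulant T(x,a,b) *)

Definition cyc_mx (R : comNzRingType) n (x a b : R) : 'M[R]_n :=
  \matrix_(i, j) (x *+ (j == i) + a *+ (j == ordS i) + b *+ (i == ordS j)).

Lemma cyc_mx_diag (R : comNzRingType) n (x a b : R) (i : 'I_n) :
  (2 < n)%N -> cyc_mx n x a b i i = x.
Proof.
by move=> n2; rewrite mxE eqxx eq_sym (negPf (ordS_neq _ _)) ?(ltnW n2) // !addr0.
Qed.

Lemma cyc_mx_up (R : comNzRingType) n (x a b : R) (i : 'I_n) :
  (2 < n)%N -> cyc_mx n x a b i (ordS i) = a.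
Proof.
move=> n2; rewrite mxE eqxx (negPf (ordS_neq _ _)) ?(ltnW n2) //.
by rewrite eq_sym (negPf (ordSS_neq _ _)) // add0r addr0.
Qed.

Lemma cyc_mx_down (R : comNzRingType) n (x a b : R) (i : 'I_n) :
  (2 < n)%N -> cyc_mx n x a b (ordS i) i = b.
Proof.
move=> n2; rewrite mxE eqxx eq_sym (negPf (ordS_neq _ _)) ?(ltnW n2) //.
by rewrite eq_sym (negPf (ordSS_neq _ _)) // !add0r.
Qed.

Lemma prod_cyc_mx_rot (R : comNzRingType) n (x a b : R) : (2 < n)%N ->
  \prod_i cyc_mx n x a b i (rot_perm n i) = a ^+ n.
Proof.
move=> n2; under eq_bigr do rewrite permE cyc_mx_up //.
by rewrite prodr_const card_ord.
Qed.

Lemma prod_cyc_mx_rotV (R : comNzRingType) n (x a b : R) : (2 < n)%N ->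
  \prod_i cyc_mx n x a b i ((rot_perm n)^-1%g i) = b ^+ n.
Proof.
move=> n2; rewrite (reindex_inj (@perm_inj _ (rot_perm n))).
under eq_bigr do rewrite permK permE cyc_mx_down //.
by rewrite prodr_const card_ord.
Qed.

(* A permutation other than the two rotations contributes to either expansion
   only if it is a product of k disjoint transpositions (i, i+1), each of which
   carries the factor (-1)^2 on the left and a b = -1 on the right. *)
Lemma prod_cyc_mx_sign (R : comNzRingType) n (x a b : R) (s : 'S_n) :
    (2 < n)%N -> a * b = -1 -> s != rot_perm n -> s != (rot_perm n)^-1%g ->
  \prod_i cyc_mx n x (-1) (-1) i (s i) =
    (-1) ^+ s * \prod_i cyc_mx n x a b i (s i).
Proof.
move=> n2 ab sr srV.
have [/forallP ds|] :=
    boolP [forall i, [|| s i == i, s i == ordS i | i == ordS (s i)]]; last first.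
  rewrite negb_forall => /existsP[i /norP[/negPf e1 /norP[/negPf e2 /negPf e3]]].
  have z a' b' : \prod_i cyc_mx n x a' b' i (s i) = 0.
    by rewrite (bigD1 i) //= mxE e1 e2 e3 !addr0 mul0r.
  by rewrite !z mulr0.
have {}ds : near_diag s.
  by move=> i; case/or3P: (ds i) => /eqP; [apply: Or31|apply: Or32|apply: Or33].
have sK := near_diag_involution n2 ds sr srV.
pose A := [set i | s i == ordS i].
have sA i : (s i \in A) = (i == ordS (s i)) by rewrite inE sK.
have -> : odd_perm s = odd #|A|.
  apply: odd_perm_involution => // i.
    by rewrite inE => /eqP ->; rewrite ordS_neq // ltnW.
  move=> si; rewrite sA inE; case: (ds i) => e.
  - by rewrite e eqxx in si.
  - by rewrite e eqxx eq_sym (negPf (ordSS_neq _ _)).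
  - by rewrite -e eqxx {2}e eq_sym (negPf (ordSS_neq _ _)).
(* [w] converts entries -1 into [a] (forward step) or [b] (backward step). Reindexing by [s] brings
   the two factors of a transposition together, giving (-a)(-b) = -1 per point of [A]. *)
pose w i := (if i \in A then - a else 1) * (if s i \in A then - b else 1).
have -> : \prod_i cyc_mx n x a b i (s i) =
          \prod_i w i * \prod_i cyc_mx n x (-1) (-1) i (s i).
  rewrite -big_split; apply: eq_bigr => i _ /=; rewrite /w sA inE.
  case: (ds i) => e.
  - rewrite e eq_sym (negPf (ordS_neq _ _)) ?(ltnW n2) //.
    by rewrite !cyc_mx_diag // !mul1r.
  - rewrite e eqxx eq_sym (negPf (ordSS_neq _ _)) // !cyc_mx_up //.
    by rewrite mulr1 mulrN1 opprK.
  - move: (s i) e => j ->.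
    rewrite eqxx eq_sym (negPf (ordSS_neq _ _)) // !cyc_mx_down //.
    by rewrite mul1r mulrN1 opprK.
have -> : \prod_i w i = (-1) ^+ #|A|.
  have e : \prod_j (if j \in A then - b else 1) =
           \prod_i (if s i \in A then - b else 1)
    by rewrite (reindex_inj (@perm_inj _ s)).
  rewrite big_split /= -e -big_split /= -prodr_const.
  rewrite [RHS]big_mkcond /=; apply: eq_bigr => i _.
  by case: ifP; rewrite ?mulr1 // mulrNN.
by rewrite mulrA signr_odd -exprD addnn -mul2n exprM sqrrN !expr1n mul1r.
Qed.

(** Only the rotations differ: they give 2(-1)^n in the permanent and, having sign -(-1)^n, -(-1)^n
    (a^n + b^n) in the determinant. *)
Lemma permanent_cyc_mx (R : comNzRingType) n (x a b : R) :
    (2 < n)%N -> a * b = -1 ->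
  permanent (cyc_mx n x (-1) (-1)) =
    \det (cyc_mx n x a b) + (-1) ^+ n * (a ^+ n + b ^+ n + 2).
Proof.
move=> n2 ab; apply/eqP; rewrite addrC -subr_eq /permanent /determinant.
rewrite -sumrB (bigD1 (rot_perm n)) //= (bigD1 (rot_perm n)^-1%g) /=; last first.
  have n0 : (0 < n)%N by rewrite (ltn_trans _ n2).
  pose i := Ordinal n0; apply/eqP => /permP /(_ (rot_perm n i)) /eqP.
  by rewrite permK !permE eq_sym (negPf (ordSS_neq _ _)).
rewrite [X in _ + (_ + X)]big1 => [|s /andP[sr srV]]; last first.
  by rewrite -prod_cyc_mx_sign // subrr.
rewrite !prod_cyc_mx_rot // !prod_cyc_mx_rotV // odd_permV.
have -> : (-1) ^+ rot_perm n = - (-1) ^+ n :> R.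
  by case: n n2 => // n n2; rewrite odd_rot_perm signr_odd exprS mulN1r opprK.
apply/eqP; ring.
Qed.

(** * Diagonalisation of the circulant *)

Lemma sum_cyc_mx (R : comNzRingType) n (x a b : R) (v : 'I_n -> R) i :
  \sum_j cyc_mx n x a b i j * v j = x * v i + a * v (ordS i) + b * v (ord_pred i).
Proof.
have delta y k : \sum_j (y *+ (j == k)) * v j = y * v k.
  rewrite (bigD1 k) //= eqxx big1 ?addr0 // => j /negPf ->.
  by rewrite mul0r.
rewrite -!delta -!big_split; apply: eq_bigr => j _ /=.
by rewrite mxE !mulrDl (eq_sym i) -(can2_eq (@ordSK n) (@ord_predK n)).
Qed.

(** The Vandermonde columns (z^i), z = w^k, are eigenvectors, since z^n = 1 absorbs the wrap-around;
    the nonzero Vandermonde determinant then cancels. *)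
Lemma det_cyc_mx (F : fieldType) n (c w : F) : n.-primitive_root w -> c != 0 ->
  \det (cyc_mx n 'X (- c)%:P c^-1%:P) =
    \prod_(k < n) ('X - (c * w ^+ k - (c * w ^+ k)^-1)%:P).
Proof.
move=> pw c0; set T := cyc_mx _ _ _ _.
have n0 := prim_order_gt0 pw.
have w0 : w != 0.
  apply: contra_eq_neq (prim_expr_order pw) => ->.
  by rewrite expr0n gtn_eqF // eq_sym oner_neq0.
pose V : 'M[F]_n := Vandermonde n (\row_(k < n) w ^+ k).
pose D := \row_(k < n) ('X - (c * w ^+ k - (c * w ^+ k)^-1)%:P).
have V0 : \det V != 0.
  rewrite det_Vandermonde; apply/prodf_neq0 => i _; apply/prodf_neq0 => j ij.
  rewrite !mxE subr_eq0 (eq_prim_root_expr pw) !modn_small //.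
  by rewrite gtn_eqF.
have TV : T *m map_mx polyC V = map_mx polyC V *m diag_mx D.
  apply/matrixP => i k; rewrite mul_mx_diag !mxE sum_cyc_mx !mxE.
  set z := w ^+ k; have z0 : z != 0 by rewrite expf_neq0.
  have zn : z ^+ n = 1 by rewrite exprAC (prim_expr_order pw) expr1n.
  have zS (j : 'I_n) : z ^+ ordS j = z ^+ j * z by rewrite /= expr_mod // exprSr.
  have zP : z ^+ ord_pred i = z ^+ i / z.
    by rewrite -{2}(ord_predK i) zS mulfK.
  by rewrite zS zP invfM !(polyCM, polyCB, polyCN); ring.
apply: (@mulIf _ (\det (map_mx polyC V))); first by rewrite det_map_mx polyC_eq0.
rewrite -det_mulmx TV det_mulmx mulrC det_diag; congr (_ * _).
by apply: eq_bigr => k _; rewrite mxE.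
Qed.

(** * Permanental polynomial and energy of the cycle *)

Lemma char_poly_mx_cycle (F : comNzRingType) n : (2 < n)%N ->
  char_poly_mx (adjmx F (cycle_graph n)) = cyc_mx n 'X (-1) (-1).
Proof.
move=> n2; apply/matrixP => i j; rewrite !mxE /= /cycle_rel (eq_sym j i).
have [<-|_] := eqVneq i j.
  by rewrite eq_sym (negPf (ordS_neq _ _)) ?(ltnW n2) // subr0 !addr0.
have [->|_] := eqVneq j (ordS i).
  by rewrite eq_sym (negPf (ordSS_neq _ _)) // addr0.
by case: eqP => _; rewrite /= ?subr0 ?addr0.
Qed.

Lemma permanental_poly_cycle (F : fieldType) n (c w : F) : (2 < n)%N ->
    n.-primitive_root w -> c != 0 -> (- c) ^+ n + c ^- n = -2 ->
  permanental_poly F (cycle_graph n) =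
    \prod_(k < n) ('X - (c * w ^+ k - (c * w ^+ k)^-1)%:P).
Proof.
move=> n2 pw c0 cn; rewrite /permanental_poly char_poly_mx_cycle //.
rewrite (@permanent_cyc_mx _ n _ (- c)%:P c^-1%:P) //; last first.
  by rewrite -polyCM mulNr divff // polyCN.
rewrite (det_cyc_mx pw c0) -!polyC_exp exprVn -polyCD cn polyCN polyCMn.
by rewrite addNr mulr0 addr0.
Qed.

Lemma permanental_energy_cycle (R : realType) n (c w : R[i]) : (2 < n)%N ->
    n.-primitive_root w -> c != 0 -> (- c) ^+ n + c ^- n = -2 ->
  permanental_energy R (cycle_graph n) =
    \sum_(k < n) ComplexField.Normc.normc (c * w ^+ k - (c * w ^+ k)^-1).
Proof.
move=> n2 pw c0 cn; rewrite /permanental_energy /poly_roots.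
case: closed_field_poly_normal => r /=.
rewrite (permanental_poly_cycle n2 pw c0 cn).
rewrite lead_coef_prod_XsubC scale1r.
(* Two lists of roots of the same product of linear factors agree up to order, which the sum
   ignores. *)
rewrite -(big_image _ _ _ _ (fun z => 'X - z%:P)) /= => /prod_XsubC_eq rE.
by rewrite -(perm_big _ rE) big_image.
Qed.

(** * Complex exponentials e^(it), moduli and roots of unity *)

Definition cis (R : realType) (t : R) : R[i] := (cos t +i* sin t)%C.

Lemma cis0 (R : realType) : cis 0 = 1 :> R[i].
Proof. by rewrite /cis cos0 sin0. Qed.

Lemma cisD (R : realType) (s t : R) : cis (s + t) = cis s * cis t.
Proof.
by rewrite /cis cosD sinD; apply/eqP; rewrite eq_complex /= !eqxx /= addrC.
Qed.

Lemma cisX (R : realType) (t : R) k : cis t ^+ k = cis (k%:R * t).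
Proof.
elim: k => [|k IH]; first by rewrite mul0r cis0.
by rewrite exprS IH -cisD mulrS mulrDl mul1r.
Qed.

Lemma cis_neq0 (R : realType) (t : R) : cis t != 0.
Proof.
apply/eqP => t0; have := cisD t (- t); rewrite subrr cis0 t0 mul0r.
by move/eqP; rewrite oner_eq0.
Qed.

Lemma cispi (R : realType) : cis pi = -1 :> R[i].
Proof.
by rewrite /cis cospi sinpi; apply/eqP; rewrite eq_complex /= oppr0 !eqxx.
Qed.

Lemma cis_eq1 (R : realType) (t : R) : cis t = 1 -> sin t = 0.
Proof. by case. Qed.

(** The number is (r - 1/r) cos t + i (r + 1/r) sin t, and (r + 1/r)^2 = (r - 1/r)^2 + 4. *)
Lemma normc_subV (R : realType) (r t : R) : r != 0 ->
  ComplexField.Normc.normc (r%:C%C * cis t - (r%:C%C * cis t)^-1) =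
    Num.sqrt ((r - r^-1) ^+ 2 + 4 * sin t ^+ 2).
Proof.
move=> r0.
have -> : (r%:C%C * cis t)^-1 = (r^-1 * cos t +i* (- (r^-1 * sin t)))%C.
  apply: (@mulfI _ (r%:C%C * cis t)).
    by rewrite mulf_neq0 ?cis_neq0 // fmorph_eq0.
  rewrite divff; last by rewrite mulf_neq0 ?cis_neq0 // fmorph_eq0.
  have := cos2Dsin2 t; have := divff r0; rewrite /cis => rV cs.
  apply/eqP; rewrite eq_complex /=; apply/andP; split; apply/eqP; last by ring.
  by transitivity (r / r * (cos t ^+ 2 + sin t ^+ 2));
    [rewrite rV cs mul1r|ring].
rewrite /cis /=; congr Num.sqrt.
have := cos2Dsin2 t; have := divff r0 => rV cs.
transitivity ((r - r^-1) ^+ 2 * (cos t ^+ 2 + sin t ^+ 2) +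
  4 * (r / r) * sin t ^+ 2); last by rewrite cs rV !mulr1.
ring.
Qed.

Lemma sin_frac_pi_gt0 (R : realType) n k : (0 < k < n)%N ->
  0 < sin (k%:R * (pi / n%:R)) :> R.
Proof.
move=> /andP[k0 kn]; have n0 : (0 < n)%N by apply: leq_trans kn.
apply: sin_gt0_pi; rewrite mulrCA; apply/andP; split.
  by rewrite !mulr_gt0 ?pi_gt0 ?ltr0n ?invr_gt0 ?ltr0n.
by rewrite gtr_pMr ?pi_gt0 // ltr_pdivrMr ?ltr0n // mul1r ltr_nat.
Qed.

Lemma cis_primitive_root (R : realType) n (t : R) : (0 < n)%N ->
    cis t ^+ n = 1 -> (forall k, (0 < k < n)%N -> cis (k%:R * t) != 1) ->
  n.-primitive_root (cis t).
Proof.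
move=> n0 tn tk; apply/andP; split=> //; apply/forallP => i.
rewrite unity_rootE; have [->|ne] := eqVneq i.+1 n; first by rewrite tn eqxx.
by rewrite cisX (negPf (tk _ _)) //= ltn_neqAle ne ltn_ord.
Qed.

Lemma primitive_root_cis_2pi (R : realType) n : (0 < n)%N ->
  n.-primitive_root (cis (2 * (pi / n%:R)) : R[i]).
Proof.
move=> n0; have nn0 : n%:R != 0 :> R by rewrite pnatr_eq0 -lt0n.
apply: cis_primitive_root => // [|k kn].
  rewrite cisX (mulrCA n%:R 2) (mulrCA n%:R pi) mulfV // mulr1.
  by rewrite mulr_natl mulr2n cisD cispi mulrNN mulr1.
(* cos 2y = 1 would force sin y = 0, but 0 < y < pi. *)
have := sin_frac_pi_gt0 R kn; set y := k%:R * (pi / n%:R) => sy.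
rewrite mulrCA -/y mulr_natl mulr2n; apply/eqP => -[].
rewrite cosD => c2 _; have := cos2Dsin2 y; nra.
Qed.

Lemma sin2_kpiD (R : realType) k (y : R) : sin (k%:R * pi + y) ^+ 2 = sin y ^+ 2.
Proof.
elim: k => [|k IH]; first by rewrite mul0r add0r.
by rewrite mulrS mulrDl mul1r -addrA addrC sinDpi sqrrN.
Qed.

(* For odd n the angle pi + pi/n generates the same group as 2 pi/n; its k-th
   multiple has sine +-sin(k pi/n), with k pi/n in [0, pi). *)
Lemma primitive_root_cis_odd (R : realType) n : odd n ->
  n.-primitive_root (cis (pi + pi / n%:R) : R[i]).
Proof.
move=> on; have n0 : (0 < n)%N by case: n on.
have nn0 : n%:R != 0 :> R by rewrite pnatr_eq0 -lt0n.
apply: cis_primitive_root => // [|k kn].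
  rewrite cisX mulrDr cisD -cisX mulrCA mulfV // mulr1 cispi -signr_odd on.
  by rewrite mulrNN mulr1.
apply/eqP => /cis_eq1 s0; have := sin_frac_pi_gt0 R kn; apply/negP.
by rewrite lt0r -sqrf_eq0 -(sin2_kpiD k) -mulrDr s0 expr0n eqxx.
Qed.

(** * Sums of sines *)

Lemma natr_doubleS (R : comNzRingType) k : k.*2.+1%:R = 2 * k%:R + 1 :> R.
Proof. by rewrite -addn1 natrD -mul2n natrM. Qed.

(** Telescopes: sin((2k+1)t) sin t = sin((k+1)t)^2 - sin(kt)^2. *)
Lemma sum_sin_odd (R : realType) m (t : R) :
  (\sum_(k < m) sin (k.*2.+1%:R * t)) * sin t = sin (m%:R * t) ^+ 2.
Proof.
elim: m => [|m IH]; first by rewrite big_ord0 !mul0r sin0 expr0n.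
rewrite big_ord_recr /= mulrDl IH.
have -> : m.*2.+1%:R * t = m%:R * t + m%:R * t + t.
  by rewrite natr_doubleS; ring.
have -> : m.+1%:R * t = m%:R * t + t by rewrite -addn1 natrD; ring.
set y := m%:R * t; have := cos2Dsin2 t => cs.
rewrite !sinD !cosD -[X in X + _]mulr1 -cs; ring.
Qed.

(** Telescopes: 2 sin(2kh) sin h = cos((2k-1)h) - cos((2k+1)h). *)
Lemma sum_sin_even (R : realType) n (h : R) :
  (\sum_(k < n) 2 * sin (k%:R * (2 * h))) * sin h = cos h - cos (n%:R * (2 * h) - h).
Proof.
elim: n => [|n IH]; first by rewrite big_ord0 !mul0r sub0r cosN subrr.
rewrite big_ord_recr /= mulrDl IH.
have -> : n.+1%:R * (2 * h) - h = n%:R * (2 * h) + h.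
  by rewrite -addn1 natrD; ring.
rewrite cosB cosD; ring.
Qed.

(** * Exact energy for even n, two-sided bound for odd n *)

Lemma permanental_energy_cycle_even (R : realType) n : (2 < n)%N -> ~~ odd n ->
  permanental_energy R (cycle_graph n) = 4 / sin (pi / n%:R).
Proof.
move=> n2 en; have n0 : (0 < n)%N by apply: ltn_trans n2.
have nn0 : n%:R != 0 :> R by rewrite pnatr_eq0 -lt0n.
have cn : cis (pi / n%:R) ^+ n = -1 :> R[i].
  by rewrite cisX mulrCA mulfV // mulr1 cispi.
rewrite (@permanental_energy_cycle _ _ (cis (pi / n%:R)) (cis (2 * (pi / n%:R))))
  ?cis_neq0 ?primitive_root_cis_2pi //; last first.
  by rewrite exprNn cn -signr_odd (negPf en) invrN1; ring.
set t := pi / n%:R.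
have st : 0 < sin t.
  by have := @sin_frac_pi_gt0 R n 1; rewrite mul1r; apply; exact: ltn_trans n2.
pose m := n./2; have nE : n = (m + m)%N.
  by rewrite addnn -[LHS]odd_double_half (negPf en).
have mt : m%:R * t + m%:R * t = pi.
  by rewrite -mulrDl -natrD -nE mulrCA mulfV // mulr1.
have mt2 : m%:R * t = pi / 2 by lra.
have -> : \sum_(k < n) ComplexField.Normc.normc
      (cis t * cis (2 * t) ^+ k - (cis t * cis (2 * t) ^+ k)^-1) =
    \sum_(k < n) 2 * `|sin (k.*2.+1%:R * t)|.
  apply: eq_bigr => k _.
  have -> : cis t * cis (2 * t) ^+ k = 1%:C%C * cis (k.*2.+1%:R * t) :> R[i].
    rewrite cisX -cisD mul1r; congr cis.
    by rewrite natr_doubleS; ring.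
  rewrite normc_subV ?oner_neq0 // invr1 subrr expr0n add0r.
  have -> : 4 = 2 ^+ 2 :> R by ring.
  by rewrite -exprMn sqrtr_sqr normrM normr_nat.
rewrite -mulr_sumr; apply: (mulIf (lt0r_neq0 st)); rewrite mulfVK ?lt0r_neq0 //.
(* For k < m the angle lies in (0, pi), so the absolute values drop and the sum telescopes to
   sin(pi/2)^2. *)
have sm : (\sum_(k < m) `|sin (k.*2.+1%:R * t)|) * sin t = 1.
  transitivity ((\sum_(k < m) sin (k.*2.+1%:R * t)) * sin t).
    congr (_ * _); apply: eq_bigr => k _; apply/ger0_norm/ltW.
    by apply: sin_frac_pi_gt0; rewrite /= nE; have := ltn_ord k; lia.
  by rewrite sum_sin_odd mt2 sin_pihalf expr1n.
(* Shifting k by m adds 2mt = pi to the angle, so the second half repeats the first up to sign. *)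
have -> : \sum_(k < n) `|sin (k.*2.+1%:R * t)| =
    \sum_(k < m) `|sin (k.*2.+1%:R * t)| + \sum_(k < m) `|sin (k.*2.+1%:R * t)|.
  rewrite -!(big_mkord xpredT (fun k => `|sin (k.*2.+1%:R * t)|)).
  rewrite (big_cat_nat (n := m)) ?nE ?leq_addr //=; congr (_ + _).
  rewrite -{1}[m]add0n big_addn addnK; apply: eq_bigr => k _.
  have -> : (k + m).*2.+1%:R * t = k.*2.+1%:R * t + pi.
    by rewrite -mt !natr_doubleS natrD; ring.
  by rewrite sinDpi normrN.
by rewrite -mulrA [X in 2 * X]mulrDl sm; ring.
Qed.

(** With d = r - 1/r and y = sin(k pi/n), each modulus sqrt(d^2 + (2y)^2) lies between 2y and 2y +
    d; summing the 2y gives the cotangent term. *)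
Lemma permanental_energy_cycle_odd (R : realType) n (r : R) : (2 < n)%N -> odd n ->
    1 <= r -> r ^+ n = 1 + Num.sqrt 2 ->
  2 * (cos (pi / n%:R / 2) / sin (pi / n%:R / 2)) <=
    permanental_energy R (cycle_graph n) <=
  2 * (cos (pi / n%:R / 2) / sin (pi / n%:R / 2)) + n%:R * (r - r^-1).
Proof.
move=> n2 on r1 rn; have n0 : (0 < n)%N by apply: ltn_trans n2.
have nn0 : n%:R != 0 :> R by rewrite pnatr_eq0 -lt0n.
have r0 : r != 0 by rewrite gt_eqF // (lt_le_trans ltr01).
have rC0 : r%:C%C != 0 :> R[i] by rewrite fmorph_eq0.
have s2 : Num.sqrt 2 ^+ 2 = 2 :> R by rewrite sqr_sqrtr.
(* u = 1 + sqrt 2 has inverse sqrt 2 - 1, hence -u + 1/u = -2. *)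
have rVn : r ^- n = Num.sqrt 2 - 1.
  rewrite rn; apply: (@mulfI _ (1 + Num.sqrt 2)); first by rewrite -rn expf_neq0.
  rewrite divff; last by rewrite -rn expf_neq0.
  by transitivity (Num.sqrt 2 ^+ 2 - 1 : R); [rewrite s2|]; ring.
have cn : (- r%:C%C) ^+ n + r%:C%C ^- n = -2 :> R[i].
  rewrite exprNn -signr_odd on mulN1r -rmorphXn -fmorphV rVn rn.
  by rewrite rmorphB rmorphD rmorph1; ring.
rewrite (permanental_energy_cycle n2 (primitive_root_cis_odd R on) rC0 cn).
set h := pi / n%:R / 2.
have hE : pi / n%:R = 2 * h by rewrite /h; field.
have sh : 0 < sin h.
  apply: sin_gt0_pi; apply/andP; split; rewrite /h.
    by rewrite !divr_gt0 ?pi_gt0 ?ltr0n.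
  rewrite -mulrA -invfM gtr_pMr ?pi_gt0 // invf_lt1 ?mulr_gt0 ?ltr0n //.
  by rewrite -natrM ltr1n; lia.
have -> : 2 * (cos h / sin h) = \sum_(k < n) 2 * sin (k%:R * (pi / n%:R)).
  apply: (mulIf (lt0r_neq0 sh)); rewrite hE sum_sin_even -hE.
  rewrite (mulrCA n%:R pi) mulfV // mulr1 -mulrA.
  by rewrite mulfVK ?lt0r_neq0 // (addrC pi) cosDpi cosN; ring.
have -> : n%:R * (r - r^-1) = \sum_(k < n) (r - r^-1).
  by rewrite sumr_const card_ord mulr_natl.
have rV : 0 <= r - r^-1.
  by rewrite subr_ge0 (le_trans _ r1) // invf_le1 // (lt_le_trans ltr01).
have key (k : 'I_n) :
    2 * sin (k%:R * (pi / n%:R)) <=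
      ComplexField.Normc.normc (r%:C%C * cis (pi + pi / n%:R) ^+ k
        - (r%:C%C * cis (pi + pi / n%:R) ^+ k)^-1) <=
    2 * sin (k%:R * (pi / n%:R)) + (r - r^-1).
  rewrite cisX normc_subV // mulrDr sin2_kpiD.
  set y := sin _; have y0 : 0 <= y.
    have [k0|k0] := posnP k; first by rewrite /y k0 mul0r sin0.
    by apply/ltW/sin_frac_pi_gt0; rewrite k0 /=.
  move: rV; set d := r - r^-1 => d0.
  have y2 : 0 <= 2 * y by rewrite mulr_ge0.
  have y3 : 0 <= 2 * y + d by rewrite addr_ge0.
  have y4 : 0 <= d ^+ 2 + 4 * y ^+ 2 by nra.
  rewrite -[X in X <= _ <= _](ger0_norm y2) -[X in _ <= _ <= X](ger0_norm y3).
  rewrite -!sqrtr_sqr !ler_sqrt ?sqr_ge0 //.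
  by apply/andP; split; nra.
apply/andP; split; first by apply: ler_sum => k _; case/andP: (key k).
by rewrite -big_split /=; apply: ler_sum => k _; case/andP: (key k).
Qed.

(** * Limit along odd n *)

Local Open Scope classical_set_scope.
Local Open Scope ring_scope.

Lemma cvg_invn (R : realType) : (n%:R : R)^-1 @[n --> \oo] --> (0 : R).
Proof. by rewrite -(cvg_shiftS (fun n => (n%:R : R)^-1)); exact: cvg_harmonic. Qed.

(** This is the difference quotient of [sin] at 0, with limit [cos 0]. *)
Lemma cvg_sinx_div_x (R : realType) : sin x / x @[x --> (0 : R)^'] --> (1 : R).
Proof.
have [d e] := is_derive_sin (0 : R).
have : h^-1 *: ((sin \o shift 0) (h *: 1) - sin 0)
    @[h --> (0 : R)^'] --> 'D_1 sin (0 : R) := d.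
rewrite e cos0.
under eq_fun do rewrite /= addr0 sin0 subr0 /GRing.scale /= mulr1 mulrC.
by [].
Qed.

Theorem theorem4p6 (R : realType) :
  (forall n : nat, (3 <= n)%N -> ~~ odd n ->
     permanental_energy R (cycle_graph n) = 4 / sin (pi / n%:R)) /\
  (permanental_energy R (cycle_graph n) / n%:R
     @[n --> within [set n : nat | odd n] \oo] --> (4 / pi : R)).
Proof.
split; first exact: permanental_energy_cycle_even.
pose h (n : nat) : R := pi / n%:R / 2.
(* The n-th root of 1 + sqrt 2, written as an exponential so that continuity of [expR] gives its
   limit 1. *)
pose r (n : nat) : R := expR (ln (1 + Num.sqrt 2) / n%:R).
pose g (n : nat) : R := 2 * (cos (h n) / sin (h n)) / n%:R.
have u1 : 1 < 1 + Num.sqrt 2 :> R by rewrite ltrDl sqrtr_gt0.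
have h0 : h n @[n --> \oo] --> (0 : R).
  rewrite -(mul0r (2^-1 : R)) -(mulr0 (pi : R)).
  apply: cvgM; last exact: cvg_cst.
  by apply: cvgM; [exact: cvg_cst|exact: cvg_invn].
(* The punctured neighbourhood needs [h n] nonzero; this fails only at n = 0, where division by zero
   yields 0. *)
have h0' : h n @[n --> \oo] --> (0 : R)^'.
  move=> A /h0; apply: filterS2 (nbhs_infty_gt 0) => n n0; apply.
  by rewrite /h !mulf_neq0 ?invr_eq0 ?pnatr_eq0 ?gt_eqF ?pi_gt0 // -lt0n.
have gl : g n @[n --> \oo] --> 4 / pi.
  (* Replaces 1/n by 2h/pi to expose sin h / h. *)
  have gE n : g n = 4 / pi * (cos (h n) * (sin (h n) / h n)^-1).
    have p0 : pi != 0 :> R by rewrite gt_eqF ?pi_gt0.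
    rewrite /g invf_div; move: (sin _) (cos _) => s c; rewrite /h.
    transitivity (2 * c * (pi / pi) * (2 / 2) / n%:R / s); last by ring.
    by rewrite !divff ?pnatr_eq0 //; ring.
  under eq_fun do rewrite gE.
  have cl : cos (h n) @[n --> \oo] --> (1 : R).
    by rewrite -cos0; apply: continuous_cvg h0; exact: continuous_cos.
  have sl : (sin (h n) / h n)^-1 @[n --> \oo] --> (1^-1 : R).
    by apply: cvgV; [exact: oner_neq0|exact: cvg_comp h0' (@cvg_sinx_div_x R)].
  have := cvgM (cvg_cst (4 / pi : R)) (cvgM cl sl).
  by rewrite invr1 !mulr1; apply.
have rl : (r n - (r n)^-1) @[n --> \oo] --> (0 : R).
  have r1 : r n @[n --> \oo] --> (1 : R).
    pose L : R := ln (1 + Num.sqrt 2).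
    have Ln : L / n%:R @[n --> \oo] --> L * 0.
      by apply: cvgM; [exact: cvg_cst|exact: cvg_invn].
    have := @continuous_cvg _ _ _ \oo _ _ _ _ (@continuous_expR R _) Ln.
    by rewrite mulr0 expR0; apply.
  have := cvgB r1 (cvgV (oner_neq0 R) r1).
  by rewrite invr1 subrr; apply.
(* Division by n turns the error n(r - 1/r) into r - 1/r, which tends to 0. *)
apply: (@squeeze_cvgr _ _ _ _ g (fun n => g n + (r n - (r n)^-1))).
- apply: filterS (nbhs_infty_gt 2) => n n2 /= on.
  have n0 : 0 < n%:R :> R by rewrite ltr0n (ltn_trans _ n2).
  have r1 : 1 <= r n.
    by rewrite /r -[X in X <= _]expR0 ler_expR divr_ge0 ?ler0n // ln_ge0 // ltW.
  have rn : r n ^+ n = 1 + Num.sqrt 2.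
    rewrite /r -expRM_natl mulrCA mulfV ?gt_eqF // mulr1 lnK //.
    by rewrite posrE (lt_trans ltr01).
  have /andP[lo up] := permanental_energy_cycle_odd n2 on r1 rn.
  apply/andP; split; first by rewrite ler_pM2r ?invr_gt0.
  rewrite ler_pdivrMr // (le_trans up) //.
  by rewrite [leRHS]mulrDl mulfVK ?gt_eqF // (mulrC n%:R).
- exact: cvg_within_filter.
- by apply: cvg_within_filter; have := cvgD gl rl; rewrite addr0; apply.
Qed.
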